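(* Let $f=h+\sum_{j=1}^r a_j\zeta_j\in\mathbb{R}\langle\underline{X}\rangle$ be a noncommutative polynomial without constant term, where $h$ is a sum of Hermitian squares (SOHS), $a_j\in\mathbb{R}$ and the $\zeta_j$ are monomials. Assume that $\mathrm{rc}(\eta,i)\neq\zeta_j$ for all $1\le j\le r$, for every $i\ge 0$ and for every monomial $\eta$ of $h$. Then: (1) It is always possible to obtain a Gram-like matrix preserving extension $\widetilde f$ of $f$ with respect to $h$ by adding at most $2r+1$ terms to $f$. (2) In fact, infinitely many such $\widetilde f$ can be obtained.
   Context: Let $X_1,\dots,X_n$ be noncommuting variables, $\langle\underline X\rangle$ the free monoid of words (called monomials, including the empty word $1$), and $\mathbb{R}\langle\underline X\rangle$ the free real algebra. The involution $*$ is $\mathbb{R}$-linear, fixes each $X_i$ and reverses words. The degree of a monomial is its length; the degree of a polynomial is that of its highest-degree monomials. A polynomial is a sum of Hermitian squares (SOHS) if it equals $\sum_i g_i^*g_i$ (finite sum) with $g_i\in\mathbb{R}\langle\underline X\rangle$. For a column vector $W=(w_1,\dots,w_k)^t$ of monomials, $W^*=(w_1^*,\dots,w_k^* )$. All variables $X_1,\dots,X_n$ are assumed to be essential to express $f$, and extensions are sought in the same algebra $\mathbb{R}\langle\underline X\rangle$. Right chip function: for a word $w=Y_1Y_2\cdots Y_m$ with each $Y_l$ a single letter, $\mathrm{rc}(w,i)=Y_{m-i+1}\cdots Y_m$ if $1\le i<m$, $\mathrm{rc}(w,i)=w$ if $i\ge m$, and $\mathrm{rc}(w,0)=1$. Positive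 semidefinite Gram-like matrix: if $p$ is a SOHS of degree $2d$, a $k\times k$ real positive semidefinite matrix $G$ is a positive semidefinite Gram-like matrix of $p$ if $p=W_k^*GW_k$ for some column vector $W_k$ of $k$ distinct monomials of degree at most $d$; $W_k$ is the associated monomial vector. SOHS extension: if $f=\sum_{j=1}^m c_j\delta_j$ with distinct monomials $\delta_j$ and $c_j\in\mathbb{R}\setminus\{0\}$, a SOHS polynomial $\widetilde f\in\mathbb{R}\langle\underline X\rangle$ is a (nontrivial) SOHS extension of $f$ if $\widetilde f-f=\sum_{i=1}^{N}b_i\alpha_i$ with monomials $\alpha_i$, $b_i\in\mathbb{R}\setminus\{0\}$ and $\alpha_i\ne\delta_j$ for all $i,j$. Gram-like matrix preserving extension: a SOHS extension $\widetilde f$ of $f$ is a Gram-like matrix preserving extension with respect to a SOHS part $h$ of $f$ if there are integers $l>k>0$, an $l\times l$ positive semidefinite Gram-like matrix $G_{\widetilde f}$ of $\widetilde f$ having a $k\times k$ positive semidefinite Gram-like matrix $G_h$ of $h$ as a principal submatrix, and associated monomial vectors $W_l$ of $G_{\widetilde f}$ and $W_k$ of $G_h$ such that $W_l$ contains all entries of $W_k$ (those entries labelling the rows of the principal submatrix $G_h$).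
   Formalization: Added assumption: if a monomial w and w* both occur in f, their coefficients agree; otherwise f has no SOHS extension, e.g. f = X3^2 + X1X2 + 2X2X1 with h = X3^2. For the zero polynomial no degree bound is put on the monomial vector. *)

(* Defs.v *)
From HB Require Import structures.
From mathcomp Require Import all_boot all_order all_algebra finmap.
From mathcomp Require Import boolp classical_sets functions cardinality reals.
From mathcomp Require Import monalg.

Set Implicit Arguments.
Unset Strict Implicit.
Unset Printing Implicit Defensive.

Import Order.TTheory GRing.Theory Num.Theory.

Local Open Scope ring_scope.

(* The free monoid on X_0, ..., X_(n-1) and the free real algebra on it;
   << c *g w >> is the term c w, p@_w the coefficient of w in p, and
   msupp p the set of monomials of p. *)
Notation word n := {fmonom 'I_n}.
Notation ncpoly R n := {malg R[word n]}.

Definition wstar n (w : word n) : word n := FMonom (rev w).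

Definition pstar (R : realType) n (p : ncpoly R n) : ncpoly R n :=
  \sum_(w <- msupp p) << p@_w *g wstar w >>.

Definition is_sohs (R : realType) n (p : ncpoly R n) : Prop :=
  exists gs : seq (ncpoly R n), p = \sum_(g <- gs) pstar g * g.

(* The measure of p with respect to fdeg is 1 + deg p, and 0 for p = 0;
   thus the zero polynomial has no degree. *)
Definition has_degree (R : realType) n (p : ncpoly R n) (m : nat) : Prop :=
  mmeasure (@fdeg 'I_n) p = m.+1.

(* The suffix of length i of w; the truncated subtraction yields w itself
   for i >= size w, and the empty word for i = 0. *)
Definition rc n (w : word n) (i : nat) : word n :=
  FMonom (drop (size w - i) w).

Definition psd (R : realType) k (G : 'M[R]_k) : Prop :=
  G^T = G /\ forall x : 'cV[R]_k, 0 <= (x^T *m G *m x) 0 0.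

(* The displayed double sum is W^* G W.  A nonzero SOHS polynomial always has
   an even degree 2d; the degree bound is void exactly when p = 0. *)
Definition gram_like (R : realType) n k (p : ncpoly R n)
    (W : 'I_k -> word n) (G : 'M[R]_k) : Prop :=
  [/\ is_sohs p,
      psd G,
      injective W,
      forall d : nat, has_degree p d.*2 -> forall i, (fdeg (W i) <= d)%N
    & p = \sum_(i < k) \sum_(j < k) << G i j *g (mmul (wstar (W i)) (W j)) >>].

Definition adds_terms (R : realType) n (N : nat) (f ft : ncpoly R n) : Prop :=
  exists (b : 'I_N -> R) (alpha : 'I_N -> word n),
    [/\ injective alpha,
        forall i, b i != 0,
        forall i, alpha i \notin msupp f
      & ft - f = \sum_(i < N) << b i *g alpha i >>].

(* N > 0 excludes the trivial extension ft = f. *)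
Definition sohs_extension (R : realType) n (f ft : ncpoly R n) : Prop :=
  is_sohs ft /\ exists2 N : nat, (0 < N)%N & adds_terms N f ft.

(* The strictly increasing map s selects the rows and columns of the principal
   submatrix Gh of Gf. *)
Definition gram_preserving_extension (R : realType) n
    (f h ft : ncpoly R n) : Prop :=
  sohs_extension f ft /\
  exists (k l : nat) (Gh : 'M[R]_k) (Gf : 'M[R]_l)
         (Wk : 'I_k -> word n) (Wl : 'I_l -> word n) (s : 'I_k -> 'I_l),
    [/\ (0 < k < l)%N,
        gram_like h Wk Gh,
        gram_like ft Wl Gf,
        {homo s : i j / (i < j)%N}
      & Gh = mxsub s s Gf /\ forall i, Wk i = Wl (s i)].

Definition all_variables_essential (R : realType) n (f : ncpoly R n) : Prop :=
  forall i : 'I_n, exists2 w : word n, w \in msupp f & i \in (w : seq 'I_n).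

(* Main.v *)
Require Import Defs.
From HB Require Import structures.
From mathcomp Require Import all_boot all_order all_algebra finmap.
From mathcomp Require Import boolp classical_sets functions cardinality reals.
From mathcomp Require Import monalg.

Set Implicit Arguments.
Unset Strict Implicit.
Unset Printing Implicit Defensive.

Import Order.TTheory GRing.Theory Num.Theory.

Local Open Scope ring_scope.

(** Write [h] as a sum of Hermitian squares of polynomials [gs], let [U] be the
    union of the supports of [gs], and let [T] be the support of [f - h].  The
    extension is

      [ft = h + \sum_(v in T) (v + b_v)^* (v + b_v) + s ^ 2]

    with a free real parameter [s != 0].  Its Gram matrix along the words
    [U ++ 1 :: T] is block diagonal: the Gram matrix of [h] on [U], and an
    arrow matrix on [1 :: T].  Each [v] in [T] brings the new words
    [v^*] and [v^* v], and all of them share the constant term; this gives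
    at most [2r + 1] new terms.  The constant term of [ft] grows with [s], so that
    infinitely many extensions arise.

    Three things make this work.

    - The words of [U] are right chips of words of [h] ([newton_chip],
      [sohs_supp_rc]), so the hypothesis on right chips keeps [U] and [T]
      disjoint, and the block of [h] survives as a principal submatrix.  The
      same lemma bounds the degrees of the words of a Gram vector
      ([sohs_supp_fdeg]).
    - The new words avoid the support of [h]: [v^* v] has the right chip [v],
      and [v^*] would bring [v] along, [h] being self-adjoint
      ([mcoeff_extension_supp]).
    - The scalars [b_v] restore the coefficients of [f] on [T]
      ([mcoeff_extension_T]).  The word [v] occurs in the sum above as [v]
      itself, as the adjoint of [v^*] if [v^*] is in [T], and possibly as the
      square [u^* u] of another word of [T].  Hence [b_v] is the coefficient
      of [v] in [f], reduced by 1 in the last case, and halved if [v^*] is in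
      [T]; this is consistent because [f] is symmetric on such pairs.

    If [h = 0] then [U] is empty, whereas a principal submatrix must have a
    positive size.  One then takes for [U] a word outside [1 :: T], with a zero
    block; only its degree matters.  If [T] contains no self-adjoint word, a
    single letter serves.  Otherwise a self-adjoint word of [T] needs no new
    [v^*], and the term so saved pays for a long power of a letter added to
    [T], which makes room for a shorter power outside [T]. *)

(** * Words, adjoints and Hermitian squares *)

Section Words.
Variable n : nat.
Implicit Types u v w a b c : word n.

Lemma word_inj u v : (u : seq 'I_n) = v -> u = v.
Proof. by move=> E; apply/eqP; rewrite fmP E. Qed.

Lemma wstarK : involutive (@wstar n).
Proof. by move=> w; apply: word_inj; rewrite /= revK. Qed.

Lemma wstarM u v : wstar (mmul u v) = mmul (wstar v) (wstar u).
Proof. by apply: word_inj; rewrite fmM /= -rev_cat fmM. Qed.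

Lemma wstar1 : wstar (mone : word n) = mone.
Proof. by apply: word_inj; rewrite /= !fm1. Qed.

Lemma fdeg_wstar u : fdeg (wstar u) = fdeg u.
Proof. by rewrite !fdegE /= size_rev. Qed.

Lemma rc_mul u v : rc (mmul u v) (fdeg v) = v.
Proof.
by apply: word_inj; rewrite /rc fdegE /= fmM size_cat addnK drop_size_cat.
Qed.

Lemma rc_fdeg u : rc u (fdeg u) = u.
Proof. by apply: word_inj; rewrite /rc /= fdegE subnn drop0. Qed.

(** Cancel on the right: the last [fdeg c] letters of the two products agree,
    and on the left-hand side they lie within [b]. *)
Lemma square_suffix a b c :
  mmul (wstar a) b = mmul (wstar c) c -> (fdeg c <= fdeg b)%N -> suffix c b.
Proof.
rewrite !fdegE => /(congr1 (@fmonom_val _)); rewrite !fmM => E le_cb.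
apply/suffixP; exists (take (size b - size c) b).
have sz : size (drop (size b - size c) b) = size c by rewrite size_drop subKn.
rewrite -{1}(cat_take_drop (size b - size c) b) catA in E.
have szl := congr1 size E; rewrite !size_cat sz in szl; move/addIn: szl => szl.
move/eqP: E; rewrite eqseq_cat ?size_cat // => /andP[_ /eqP Ed].
by rewrite -{2}Ed cat_take_drop.
Qed.

Lemma square_inj u v : mmul (wstar u) u = mmul (wstar v) v -> u = v.
Proof.
move=> E; have := congr1 (@fdeg _) E; rewrite !fdegM !fdeg_wstar !addnn.
move/double_inj => Euv.
have := square_suffix E; rewrite Euv leqnn => /(_ isT) /suffixP[s Es].
apply: word_inj; have := congr1 size Es; rewrite size_cat -!fdegE Euv => /eqP.
by rewrite -{1}[fdeg v]add0n eqn_add2r eq_sym size_eq0 => /eqP s0; rewrite Es s0.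
Qed.

End Words.

(** * Gram matrices of sums of Hermitian squares *)

Section SumsOfSquares.
Variables (R : realType) (n : nat).
Implicit Types (g p : ncpoly R n) (gs : seq (ncpoly R n)) (L : seq (word n)).
Implicit Types u v w : word n.

Definition sohs gs : ncpoly R n := \sum_(g <- gs) pstar g * g.

Definition sohs_supp gs : seq (word n) :=
  undup (flatten [seq (msupp g : seq (word n)) | g <- gs]).

Definition sohs_coef gs u v : R := \sum_(g <- gs) g@_u * g@_v.

Lemma sohs_suppP gs u :
  reflect (exists2 g, g \in gs & u \in msupp g) (u \in sohs_supp gs).
Proof.
by rewrite mem_undup; apply: (iffP flatten_mapP) => -[g]; exists g.
Qed.

Lemma sum_msupp_widen (V : zmodType) L g (F : word n -> V) :
  uniq L -> {subset msupp g <= L} -> (forall u, u \notin msupp g -> F u = 0) ->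
  \sum_(u <- msupp g) F u = \sum_(u <- L) F u.
Proof.
move=> uL sL F0; rewrite [RHS](bigID (fun u => u \in msupp g)) /=.
rewrite [X in _ + X]big1 ?addr0 // -[RHS]big_filter; apply: perm_big.
apply: uniq_perm; rewrite ?filter_uniq ?fset_uniq // => u.
by rewrite mem_filter; case: (boolP (u \in msupp g)) => // /sL ->.
Qed.

(** Gram form of a sum of Hermitian squares along any list of words that
    covers the supports of the summands. *)
Lemma sohs_expand L gs : uniq L -> {subset sohs_supp gs <= L} ->
  sohs gs = \sum_(u <- L) \sum_(v <- L)
              << sohs_coef gs u v *g mmul (wstar u) v >>.
Proof.
move=> uL sL.
transitivity (\sum_(g <- gs) \sum_(u <- L) \sum_(v <- L)
  (<< g@_u * g@_v *g mmul (wstar u) v >> : ncpoly R n)); last first.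
  rewrite exchange_big /=; apply: eq_bigr => u _.
  rewrite exchange_big /=; apply: eq_bigr => v _.
  by rewrite /sohs_coef raddf_sum.
apply: eq_big_seq => g gin.
have sg : {subset msupp g <= L} by move=> u ug; apply/sL/sohs_suppP; exists g.
rewrite {1}/pstar (sum_msupp_widen uL sg); last first.
  by move=> u /mcoeff_outdom ->; rewrite monalgU0.
rewrite {2}(monalgE g) (sum_msupp_widen uL sg); last first.
  by move=> u /mcoeff_outdom ->; rewrite monalgU0.
rewrite mulr_suml; apply: eq_bigr => u _; rewrite mulr_sumr.
apply: eq_bigr => v _.
by rewrite malgM_def fgmulUU.
Qed.

Lemma mcoeff_sohs L gs w : uniq L -> {subset sohs_supp gs <= L} ->
  (sohs gs)@_w = \sum_(u <- L) \sum_(v <- L)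
                   sohs_coef gs u v *+ (mmul (wstar u) v == w).
Proof.
move=> uL sL; rewrite (sohs_expand uL sL) raddf_sum; apply: eq_bigr => u _ /=.
by rewrite raddf_sum; apply: eq_bigr => v _ /=; rewrite mcoeffU.
Qed.

Lemma sohs_coefC gs u v : sohs_coef gs u v = sohs_coef gs v u.
Proof. by apply: eq_bigr => g _; rewrite mulrC. Qed.

(** A sum of squares of reals, one of which is nonzero. *)
Lemma sohs_coef_gt0 gs u : u \in sohs_supp gs -> 0 < sohs_coef gs u u.
Proof.
case/sohs_suppP=> g gin ug; rewrite /sohs_coef lt_neqAle eq_sym.
rewrite sumr_ge0 ?andbT; last by move=> k _; rewrite -expr2 sqr_ge0.
rewrite psumr_eq0; last by move=> k _; rewrite -expr2 sqr_ge0.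
apply/negP => /allP/(_ g gin) /=.
by rewrite -expr2 sqrf_eq0 mcoeff_eq0 ug.
Qed.

Lemma uniq_sohs_supp gs : uniq (sohs_supp gs).
Proof. exact: undup_uniq. Qed.

(** The Gram coefficients are symmetric, so exchanging the two factors
    realizes the adjoint. *)
Lemma mcoeff_sohs_star gs w : (sohs gs)@_(wstar w) = (sohs gs)@_w.
Proof.
rewrite !(mcoeff_sohs _ (uniq_sohs_supp gs) (fun _ => id)) exchange_big /=.
apply: eq_bigr => u _; apply: eq_bigr => v _; rewrite sohs_coefC.
by rewrite -(inj_eq (can_inj (@wstarK n))) wstarM !wstarK.
Qed.

(** The criterion by which words are shown to belong to a sum of Hermitian
    squares: with a single factorization there is no cancellation, and the
    coefficient is a diagonal Gram entry. *)
Lemma mcoeff_sohs_single gs u w : u \in sohs_supp gs ->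
  mmul (wstar u) u = w ->
  (forall a b, a \in sohs_supp gs -> b \in sohs_supp gs ->
     mmul (wstar a) b = w -> a = u /\ b = u) ->
  w \in msupp (sohs gs).
Proof.
move=> us Ew only; rewrite -mcoeff_neq0.
suff -> : (sohs gs)@_w = sohs_coef gs u u by rewrite gt_eqF ?sohs_coef_gt0.
rewrite (mcoeff_sohs _ (uniq_sohs_supp gs) (fun _ => id)).
rewrite (bigD1_seq u) ?uniq_sohs_supp //= (bigD1_seq u) ?uniq_sohs_supp //=.
rewrite Ew eqxx mulr1n big_seq_cond big1 ?addr0 => [|b /andP[bs /eqP nb]].
  rewrite big_seq_cond big1 ?addr0 // => a /andP[as_ /eqP na].
  rewrite big_seq big1 // => b bs.
  by case: eqP => // /(only _ _ as_ bs)[].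
by case: eqP => // /(only _ _ us bs)[].
Qed.

(** The empty word factors only trivially, so a constant term in a summand
    cannot cancel. *)
Lemma one_notin_sohs_supp gs : (sohs gs)@_mone = 0 -> mone \notin sohs_supp gs.
Proof.
move=> h1; apply/negP => s1.
suff: mone \in msupp (sohs gs) by rewrite -mcoeff_neq0 h1 eqxx.
apply: (mcoeff_sohs_single s1) => [|a b _ _ /(congr1 (@fdeg _))].
  by rewrite wstar1 mul1m.
rewrite fdegM fdeg_wstar fdeg1 => /eqP; rewrite addn_eq0 !fdeg_eq0.
by case/andP=> /eqP-> /eqP->.
Qed.

(** Among the words of the summands that end in [u], take a longest one, [v].
    If [wstar a * b] is another factorization of [wstar v * v] then the
    longer one of [a] and [b] ends in [v], hence in [u]; so neither is longer
    than [v] and both equal it.  The word [wstar v * v] thus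
    receives only nonnegative contributions, and one that is positive. *)
Lemma newton_chip gs u : u \in sohs_supp gs ->
  exists2 v : word n, suffix u v & mmul (wstar v) v \in msupp (sohs gs).
Proof.
move=> us.
pose P k := has (fun v : word n => suffix u v && (fdeg v == k)) (sohs_supp gs).
have exP : exists k, P k.
  by exists (fdeg u); apply/hasP; exists u; rewrite // suffix_refl eqxx.
have ubP k : P k -> (k <= \max_(v <- sohs_supp gs) fdeg v)%N.
  by case/hasP => v vs /andP[_ /eqP<-]; apply: leq_bigmax_seq.
case: (ex_maxnP exP ubP) => m /hasP[v vs /andP[uv /eqP Em]] maxm.
exists v => //; apply: (mcoeff_sohs_single vs erefl).
have maxv a b : a \in sohs_supp gs -> b \in sohs_supp gs ->
    mmul (wstar a) b = mmul (wstar v) v -> (fdeg b <= fdeg v)%N.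
  move=> as_ bs E; case: leqP => // lt; have vb := square_suffix E (ltnW lt).
  move: lt; rewrite ltnNge Em maxm //; apply/hasP; exists b => //.
  by rewrite eqxx (suffix_trans uv vb).
have eqv a b : a \in sohs_supp gs -> b \in sohs_supp gs ->
    mmul (wstar a) b = mmul (wstar v) v -> (fdeg v <= fdeg b)%N -> b = v.
  move=> as_ bs E le; have /suffixP[s Es] := square_suffix E le.
  have := maxv _ _ as_ bs E; rewrite !fdegE Es size_cat -{2}[size v]add0n.
  by rewrite leq_add2r leqn0 size_eq0 => /eqP s0; apply: word_inj; rewrite Es s0.
move=> a b as_ bs E.
have E' : mmul (wstar b) a = mmul (wstar v) v.
  by have := congr1 (@wstar n) E; rewrite !wstarM !wstarK.
have := congr1 (@fdeg _) E; rewrite !fdegM !fdeg_wstar => szE.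
have lea := maxv _ _ bs as_ E'; have leb := maxv _ _ as_ bs E.
have gea : (fdeg v <= fdeg a)%N.
  by rewrite -(leq_add2r (fdeg b)) szE leq_add2l.
have geb : (fdeg v <= fdeg b)%N.
  by rewrite -(leq_add2l (fdeg a)) szE leq_add2r.
by split; [apply: (eqv b a) | apply: (eqv a b)].
Qed.

Lemma sohs_supp_rc gs u : u \in sohs_supp gs ->
  exists2 eta, eta \in msupp (sohs gs) & exists i, rc eta i = u.
Proof.
case/newton_chip => v /suffixP[s Ev] vv; eexists; first exact: vv.
exists (fdeg u).
suff -> : mmul (wstar v) v = mmul (mmul (wstar v) (FMonom s)) u by rewrite rc_mul.
by apply: word_inj; rewrite !fmM /= -catA -Ev.
Qed.

Lemma has_degree_fdeg p m w : has_degree p m -> w \in msupp p -> (fdeg w <= m)%N.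
Proof. by move=> E /(@mmeasure_mnm_lt _ _ (@fdeg 'I_n)); rewrite E. Qed.

Lemma sohs_supp_fdeg gs u d : u \in sohs_supp gs ->
  has_degree (sohs gs) d.*2 -> (fdeg u <= d)%N.
Proof.
case/newton_chip => v /suffixP[s Ev] vv /has_degree_fdeg/(_ vv).
rewrite fdegM fdeg_wstar addnn leq_double; apply: leq_trans.
by rewrite !fdegE Ev size_cat leq_addl.
Qed.

Definition gram_mx gs k (W : 'I_k -> word n) : 'M[R]_k :=
  \matrix_(i, j) sohs_coef gs (W i) (W j).

(** The quadratic form is the sum, over the summands [g], of the squares of
    [\sum_i x_i g_(W i)]. *)
Lemma psd_gram_mx gs k (W : 'I_k -> word n) : psd (gram_mx gs W).
Proof.
split=> [|x]; first by apply/matrixP => i j; rewrite !mxE sohs_coefC.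
suff -> : (x^T *m gram_mx gs W *m x) 0 0 =
          \sum_(g <- gs) (\sum_i x i 0 * g@_(W i)) ^+ 2.
  by apply: sumr_ge0 => g _; apply: sqr_ge0.
rewrite mxE; under eq_bigr => j _.
  rewrite mxE mulr_suml; under eq_bigr => i _.
    rewrite !mxE /sohs_coef mulr_sumr mulr_suml; over.
  rewrite exchange_big; over.
rewrite exchange_big /=; apply: eq_bigr => g _.
rewrite expr2 mulr_sumr; apply: eq_bigr => j _; rewrite mulr_suml.
by apply: eq_bigr => i _; rewrite -!mulrA [X in _ * (_ * X)]mulrC.
Qed.

(** The list [L] may be larger than the supports; the degree bound passes from
    words that occur in a summand to words that are no longer than these.  It is
    void for the zero polynomial, whence the premise [sohs gs != 0]. *)
Lemma gram_like_sohs L gs : uniq L -> {subset sohs_supp gs <= L} ->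
  (sohs gs != 0 -> forall u, u \in L ->
     exists2 v, v \in sohs_supp gs & (fdeg u <= fdeg v)%N) ->
  gram_like (sohs gs) (fun i : 'I_(size L) => nth mone L i)
            (gram_mx gs (fun i : 'I_(size L) => nth mone L i)).
Proof.
move=> uL sL dL; split.
- by exists gs.
- exact: psd_gram_mx.
- by move=> i j /eqP; rewrite nth_uniq // => /eqP/val_inj.
- move=> d Ed i; have n0 : sohs gs != 0.
    by apply: contra_eq_neq Ed => ->; rewrite mmeasure0.
  have [v vs] := dL n0 _ (mem_nth mone (ltn_ord i)).
  by move/leq_trans; apply; apply: sohs_supp_fdeg Ed.
- rewrite (sohs_expand uL sL) (big_nth mone) big_mkord; apply: eq_bigr => i _.
  rewrite (big_nth mone) big_mkord; apply: eq_bigr => j _.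
  by rewrite mxE.
Qed.

Lemma adds_terms_msupp (f ft : ncpoly R n) :
  (forall w, w \in msupp f -> ft@_w = f@_w) ->
  adds_terms (size (msupp (ft - f))) f ft.
Proof.
move=> same; pose D := ft - f.
exists (fun i => D@_(nth mone (msupp D) i)), (fun i => nth mone (msupp D) i).
split.
- by move=> i j /eqP; rewrite nth_uniq ?fset_uniq // => /eqP/val_inj.
- by move=> i; rewrite mcoeff_neq0 mem_nth.
- move=> i; apply/negP => /same E.
  have : nth mone (msupp D) i \in msupp D by rewrite mem_nth.
  by rewrite -mcoeff_neq0 mcoeffB E subrr eqxx.
- by rewrite -/D {1}(monalgE D) (big_nth mone) big_mkord.
Qed.

End SumsOfSquares.

(** * The extension *)

Section Extension.
Variables (R : realType) (n : nat).
Implicit Types (f : ncpoly R n) (gs : seq (ncpoly R n)) (T U : seq (word n)).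
Implicit Types u v w x : word n.

Lemma sohs_cat gs1 gs2 : sohs (gs1 ++ gs2) = sohs gs1 + sohs gs2.
Proof. exact: big_cat. Qed.

Lemma sohs_seq1 (g : ncpoly R n) : sohs [:: g] = pstar g * g.
Proof. exact: big_seq1. Qed.

Definition binomial (b : R) v : ncpoly R n := << v >> + << b *g mone >>.

Lemma mcoeff_binomial b v x :
  (binomial b v)@_x = (v == x)%:R + b *+ (mone == x).
Proof. by rewrite mcoeffD !mcoeffU. Qed.

Lemma mcoeff_square_binomial b v x : v != mone ->
  (sohs [:: binomial b v])@_x =
  (mmul (wstar v) v == x)%:R + b *+ (v == x) + b *+ (wstar v == x)
  + b ^+ 2 *+ (mone == x).
Proof.
move=> v1; have v1' : (mone == v) = false by rewrite eq_sym (negPf v1).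
rewrite (@mcoeff_sohs _ _ [:: v; mone]); first last.
- move=> u /sohs_suppP[g]; rewrite inE => /eqP ->.
  rewrite -mcoeff_neq0 mcoeff_binomial !inE ![_ == u]eq_sym.
  by case: (u == v); case: (u == mone); rewrite // addr0 eqxx.
- by rewrite /= inE v1.
rewrite !big_cons !big_nil !addr0 /sohs_coef !big_seq1 !mcoeff_binomial.
rewrite !eqxx v1' (negPf v1) !mulr0n !addr0 !add0r !mulr1n wstar1 !mul1m !mulm1.
by rewrite !mulr1 mul1r -expr2 addrACA -!addrA; congr (_ + _);
   rewrite addrCA !addrA.
Qed.

Lemma sum_delta T (F : word n -> R) x : uniq T ->
  \sum_(v <- T) F v *+ (v == x) = F x *+ (x \in T).
Proof.
move=> uT; have [xT|xT] := boolP (x \in T).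
  rewrite (bigD1_seq x) //= eqxx big1 ?addr0 // => v /negPf ->.
  by rewrite mulr0n.
rewrite big_seq big1 // => v vT.
by case: eqP => // E; rewrite -E vT in xT.
Qed.

(** [v |-> wstar v * v] is injective, so the left-hand sum has at most one
    nonzero term. *)
Lemma sum_squares T x : uniq T ->
  \sum_(v <- T) (mmul (wstar v) v == x)%:R
  = (x \in [seq mmul (wstar v) v | v <- T])%:R :> R.
Proof.
move=> uT; have [/mapP[u uT' ->]|xT] := boolP (x \in _).
  under eq_bigr => v _ do rewrite (inj_eq (@square_inj n)).
  by rewrite (sum_delta (fun _ => 1)) // uT'.
rewrite big_seq big1 // => v vT.
by case: eqP => // E; case/negP: xT; apply/mapP; exists v.
Qed.

(** The coefficient that gives [v] its value in [f], once the contributions to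
    [v] from a square and from the adjoint of [v] are taken into account. *)
Definition link_coef f T v : R :=
  (f@_v - (v \in [seq mmul (wstar u) u | u <- T])%:R)
  / (1 + (wstar v \in T)%:R).

Definition seeds f gs T (s : R) : seq (ncpoly R n) :=
  gs ++ [seq binomial (link_coef f T v) v | v <- T] ++ [:: << s *g mone >>].

Definition extension f gs T s := sohs (seeds f gs T s).

Lemma mcoeff_extension f gs T s x : uniq T -> mone \notin T ->
  (extension f gs T s)@_x =
  (sohs gs)@_x
  + (x \in [seq mmul (wstar v) v | v <- T])%:R
  + link_coef f T x *+ (x \in T)
  + link_coef f T (wstar x) *+ (wstar x \in T)
  + (\sum_(v <- T) link_coef f T v ^+ 2 + s ^+ 2) *+ (mone == x).
Proof.
move=> uT T1; rewrite /extension /seeds !sohs_cat !mcoeffD.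
have -> : (sohs [:: << s *g mone >> : ncpoly R n])@_x = s ^+ 2 *+ (mone == x).
  rewrite (@mcoeff_sohs _ _ [:: mone]) //; last first.
    move=> u /sohs_suppP[g]; rewrite inE => /eqP ->.
    by move/(fsubsetP msuppU_le); rewrite inE => /eqP ->; rewrite inE.
  by rewrite !big_seq1 /sohs_coef big_seq1 mcoeffUU wstar1 mul1m.
rewrite -!addrA; congr (_ + _); rewrite mulrnDl !addrA; congr (_ + _).
rewrite /sohs big_map raddf_sum /=.
transitivity (\sum_(v <- T) (
   (mmul (wstar v) v == x)%:R + link_coef f T v *+ (v == x)
   + link_coef f T v *+ (v == wstar x)
   + link_coef f T v ^+ 2 *+ (mone == x))).
  apply: eq_big_seq => v vT; rewrite -sohs_seq1 mcoeff_square_binomial.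
    by rewrite (can2_eq (@wstarK n) (@wstarK n)).
  by apply: contraNneq T1 => <-.
by rewrite !big_split /= sum_squares // !sum_delta // -sumrMnl.
Qed.

(** From here on, [T] carries all of [f - h] and contains no right chip of [h].
    It may be larger than the support of [f - h]. *)
Section Properties.
Variables (f : ncpoly R n) (gs : seq (ncpoly R n)) (T U : seq (word n)).
Local Notation h := (sohs gs).
Local Notation ft s := (extension f gs T s).
Hypotheses (uT : uniq T) (T1 : mone \notin T) (f1 : f@_mone = 0)
  (fh : forall x, x \notin T -> f@_x = h@_x)
  (fstar : forall v, v \in T -> wstar v \in T -> f@_(wstar v) = f@_v)
  (rcT : forall eta i, eta \in msupp h -> rc eta i \notin T).

Let h1 : h@_mone = 0.
Proof. by rewrite -fh. Qed.

Let hT x : x \in T -> h@_x = 0.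
Proof.
move=> xT; apply/mcoeff_outdom/negP => /(rcT (fdeg x)).
by rewrite rc_fdeg xT.
Qed.

(** Being of the form [wstar u * u] is invariant under the adjoint, and so is
    the coefficient in [f] by assumption. *)
Lemma link_coef_star v :
  v \in T -> wstar v \in T -> link_coef f T (wstar v) = link_coef f T v.
Proof.
move=> vT vsT; rewrite /link_coef wstarK vT vsT fstar //.
congr ((_ - (nat_of_bool _)%:R) / _).
apply/mapP/mapP => -[u uT' E]; exists u => //; last by rewrite E wstarM wstarK.
by rewrite -[LHS]wstarK E wstarM wstarK.
Qed.

Lemma mcoeff_extension_one s :
  (ft s)@_mone = \sum_(v <- T) link_coef f T v ^+ 2 + s ^+ 2.
Proof.
rewrite mcoeff_extension // h1 add0r wstar1 (negPf T1) eqxx !mulr0n !addr0.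
case: mapP => [[v vT /eqP]|_]; last by rewrite add0r.
by rewrite eq_sym fmM_eq1 => /andP[_ /eqP v1]; rewrite v1 (negPf T1) in vT.
Qed.

Lemma mcoeff_extension_T s x : x \in T -> (ft s)@_x = f@_x.
Proof.
move=> xT; rewrite mcoeff_extension // hT // add0r xT mulr1n.
have -> : (mone == x) = false by apply: contraNF T1 => /eqP ->.
rewrite mulr0n addr0 -addrA.
have -> : link_coef f T (wstar x) *+ (wstar x \in T)
          = link_coef f T x * (wstar x \in T)%:R.
  have [/(link_coef_star xT)->|_] := boolP (wstar x \in T).
    by rewrite mulr1.
  by rewrite mulr0.
rewrite -{1}[link_coef f T x]mulr1 -mulrDr /link_coef divfK ?subrKC //.
by rewrite addrC natr1 pnatr_eq0.
Qed.

Definition new_words :=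
  mone :: [seq wstar v | v <- T & wstar v != v]
       ++ [seq mmul (wstar v) v | v <- T].

Lemma mcoeff_extension_old s x : x \notin new_words -> (ft s)@_x = f@_x.
Proof.
have [/mcoeff_extension_T //|xT] := boolP (x \in T).
rewrite !inE mem_cat !negb_or => /and3P[x1 x2 x3].
rewrite mcoeff_extension // -fh // (negPf x3) (negPf xT) eq_sym (negPf x1).
rewrite !mulr0n !addr0.
have [xsT|_] := boolP (wstar x \in T); last by rewrite addr0.
case/mapP: x2; exists (wstar x); rewrite ?wstarK // mem_filter xsT andbT wstarK.
by apply: contraNneq xT => ->.
Qed.

(** On [T] the coefficients of [f] were restored; elsewhere the support of [f]
    is that of [h], which the new words avoid. *)
Lemma mcoeff_extension_supp s x : x \in msupp f -> (ft s)@_x = f@_x.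
Proof.
move=> xf; have [/mcoeff_extension_T //|xT] := boolP (x \in T).
have xh : x \in msupp h by rewrite -mcoeff_neq0 -fh // mcoeff_neq0.
apply: mcoeff_extension_old; rewrite inE mem_cat !negb_or; apply/and3P; split.
- by apply: contraL xh => /eqP ->; rewrite -mcoeff_eq0 h1.
- apply: contraL xh => /mapP[v]; rewrite mem_filter => /andP[_ vT] ->.
  by rewrite -mcoeff_eq0 mcoeff_sohs_star hT.
- apply/negP => /mapP[v vT Ex]; have := rcT (fdeg v) xh.
  by rewrite Ex rc_mul vT.
Qed.

Lemma size_new_words :
  size new_words = (count (fun v => wstar v != v) T + size T).+1.
Proof. by rewrite /= size_cat !size_map size_filter. Qed.

Lemma extension_adds_terms s : s != 0 ->
  exists2 N, (0 < N <= size new_words)%N & adds_terms N f (ft s).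
Proof.
move=> s0; exists (size (msupp (ft s - f)));
  last exact: (adds_terms_msupp (mcoeff_extension_supp s)).
apply/andP; split.
  rewrite -has_predT; apply/hasP; exists mone => //.
  rewrite -mcoeff_neq0 mcoeffB f1 subr0 mcoeff_extension_one gt_eqF //.
  rewrite ltr_wpDl ?sumr_ge0 // => [v _|]; first exact: sqr_ge0.
  by rewrite exprn_even_gt0.
apply: uniq_leq_size (fset_uniq _) _ => x; rewrite -mcoeff_neq0 mcoeffB subr_eq0.
by apply: contraNT => /mcoeff_extension_old ->.
Qed.

(** The words of the block of [h].  When [h = 0], this block is zero and [U]
    only has to respect the degree of the extension. *)
Hypotheses (uU : uniq U) (U_gt0 : (0 < size U)%N)
  (U1 : mone \notin U) (UT : forall u, u \in U -> u \notin T)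
  (gsU : {subset sohs_supp gs <= U})
  (Ugs : h != 0 -> {subset U <= sohs_supp gs})
  (Udeg : forall u, u \in U ->
     exists2 v, v \in sohs_supp gs ++ T & (fdeg u <= fdeg v)%N).

Lemma sohs_supp_seeds s u : s != 0 ->
  (u \in sohs_supp (seeds f gs T s))
  = [|| u \in sohs_supp gs, u \in T | u == mone].
Proof.
move=> s0; apply/sohs_suppP/or3P => [[g]|].
  rewrite !mem_cat => /or3P[ggs ug|/mapP[v vT ->]|].
  - by constructor 1; apply/sohs_suppP; exists g.
  - rewrite -mcoeff_neq0 mcoeff_binomial.
    have [<- _|_] := eqVneq v u; first by constructor 2.
    have [<-|_] := eqVneq mone u; first by constructor 3.
    by rewrite add0r mulr0n eqxx.
  - rewrite inE => /eqP ->; rewrite -mcoeff_neq0 mcoeffU.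
    have [<-|_] := eqVneq mone u; first by constructor 3.
    by rewrite eqxx.
case=> [/sohs_suppP[g ggs ug]|uT'|/eqP ->].
- by exists g; rewrite // mem_cat ggs.
- exists (binomial (link_coef f T u) u).
    by rewrite !mem_cat (map_f (fun v => binomial (link_coef f T v) v)) ?orbT.
  rewrite -mcoeff_neq0 mcoeff_binomial eqxx.
  have -> : (mone == u) = false by apply: contraNF T1 => /eqP ->.
  by rewrite addr0 oner_eq0.
- exists << s *g mone >>; first by rewrite !mem_cat inE eqxx !orbT.
  by rewrite -mcoeff_neq0 mcoeffUU.
Qed.

Let W := U ++ mone :: T.

(** The added summands live on [mone :: T], so they leave the rows of [U]
    unchanged. *)
Lemma sohs_coef_seeds s u v :
  u \in U -> sohs_coef (seeds f gs T s) u v = sohs_coef gs u v.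
Proof.
move=> uU'; have u1 : (mone == u) = false by apply: contraNF U1 => /eqP ->.
rewrite /sohs_coef /seeds !big_cat big_seq1 /= mcoeffU u1 mulr0n mul0r addr0.
rewrite big_map [X in _ + X]big_seq [X in _ + X]big1 ?addr0 // => w wT.
rewrite mcoeff_binomial u1.
have -> : (w == u) = false by apply: contraNF (UT uU') => /eqP <-.
by rewrite mulr0n addr0 mul0r.
Qed.

Lemma extension_gram_preserving s : s != 0 -> gram_preserving_extension f h (ft s).
Proof.
move=> s0; split.
  split; first by exists (seeds f gs T s).
  by case: (extension_adds_terms s0) => N /andP[N0 _] aN; exists N.
have leUW : (size U <= size W)%N by rewrite size_cat leq_addr.
exists (size U), (size W), (gram_mx gs (fun i : 'I_(size U) => nth mone U i)),
  (gram_mx (seeds f gs T s) (fun i : 'I_(size W) => nth mone W i)),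
  (fun i => nth mone U i), (fun i => nth mone W i), (widen_ord leUW).
split.
- by rewrite U_gt0 size_cat /= addnS ltnS leq_addr.
- apply: gram_like_sohs => // h0 u /(Ugs h0) us; by exists u.
- apply: gram_like_sohs.
  + rewrite cat_uniq uU cons_uniq T1 uT !andbT /= negb_or U1 /=.
    by apply/hasPn => u; apply: contraL => /UT.
  + move=> u; rewrite sohs_supp_seeds // mem_cat inE.
    by case/or3P => [/gsU ->|->|->]; rewrite ?orbT.
  + move=> _ u; rewrite mem_cat inE => /or3P[/Udeg[v]|/eqP ->|uT'].
    * rewrite mem_cat => vin le; exists v; rewrite // sohs_supp_seeds //.
      by case/orP: vin => ->; rewrite ?orbT.
    * by exists mone; rewrite // sohs_supp_seeds // eqxx !orbT.
    * by exists u; rewrite // sohs_supp_seeds // uT' orbT.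
- by [].
- have nthW (i : 'I_(size U)) : nth mone W (widen_ord leUW i) = nth mone U i.
    by rewrite nth_cat /= ltn_ord.
  split=> [|i]; last by rewrite nthW.
  apply/matrixP => i j; rewrite !mxE !nthW sohs_coef_seeds //.
  exact: mem_nth.
Qed.

(** The parameters [1, 2, 3, ...] give distinct constant terms. *)
Lemma infinitely_many_extensions M : (size new_words <= M)%N ->
  let A := [set ft : ncpoly R n |
      gram_preserving_extension f h ft /\
      exists2 N : nat, (N <= M)%N & adds_terms N f ft]%classic in
  (exists ft, A ft) /\ infinite_set A.
Proof.
move=> leM A; pose F (m : nat) := ft (m.+1%:R : R).
have AF m : A (F m).
  have s0 : m.+1%:R != 0 :> R by rewrite pnatr_eq0.
  split; first exact: extension_gram_preserving.
  have [N /andP[_ leN] aN] := extension_adds_terms s0.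
  by exists N => //; apply: leq_trans leN leM.
split; first by exists (F 0%N); apply: AF.
have Finj : injective F.
  move=> i j /(congr1 (mcoeff mone)); rewrite !mcoeff_extension_one.
  by move/addrI/eqP; rewrite eqrXn2 ?ler0n // eqr_nat eqSS => /eqP.
apply: (@sub_infinite_set _ (range F)); first by move=> _ [m _ <-]; apply: AF.
apply/infiniteP.
by have := inj_card_eq (A := setT) (in2W Finj); rewrite card_eq_le => /andP[].
Qed.

End Properties.
End Extension.

(** * Choice of the words *)

Lemma msupp_sum_codom (R : realType) n r (a : 'I_r -> R) (zeta : 'I_r -> word n) :
  {subset msupp (\sum_(j < r) << a j *g zeta j >> : ncpoly R n) <= codom zeta}.
Proof.
move=> w; rewrite -mcoeff_neq0 raddf_sum /=; apply: contraNT => wz.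
rewrite big1 // => j _; rewrite mcoeffU; case: eqP => // E.
by rewrite -E codom_f in wz.
Qed.

Local Open Scope classical_set_scope.

(* Hadj: f never has a word and its adjoint with two different nonzero
   coefficients.  Otherwise no SOHS extension of f exists, since an extension
   keeps the coefficients of f and a SOHS polynomial is self-adjoint. *)
Theorem theorem3p24 (R : realType) (n : nat) (f h : ncpoly R n)
    (r : nat) (a : 'I_r -> R) (zeta : 'I_r -> word n)
    (Hn : (0 < n)%N)
    (Hess : all_variables_essential f)
    (Hconst : f@_mone = 0)
    (Hsohs : is_sohs h)
    (Hf : f = h + \sum_(j < r) << a j *g zeta j >>)
    (Hrc : forall (j : 'I_r) (i : nat) (eta : word n),
        eta \in msupp h -> rc eta i <> zeta j)
    (Hadj : forall w : word n,
        w \in msupp f -> wstar w \in msupp f -> f@_(wstar w) = f@_w) :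
  (exists ft : ncpoly R n,
      gram_preserving_extension f h ft /\
      exists2 N : nat, (N <= r.*2.+1)%N & adds_terms N f ft) /\
  infinite_set
    [set ft : ncpoly R n |
      gram_preserving_extension f h ft /\
      exists2 N : nat, (N <= r.*2.+1)%N & adds_terms N f ft].
Proof.
case: Hsohs => gs Eh; set g : ncpoly R n := \sum_(j < r) _ in Hf.
have gz : {subset msupp g <= codom zeta} by exact: msupp_sum_codom.
set S := msupp g : seq (word n).
have uS : uniq S by exact: fset_uniq.
have sizeS : (size S <= r)%N.
  by rewrite -{1}[r]card_ord -(size_codom zeta) uniq_leq_size.
have rcS eta i : eta \in msupp h -> rc eta i \notin S.
  by move=> eh; apply/negP => /gz /codomP[j]; apply: Hrc.
have fhS x : x \notin S -> f@_x = h@_x.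
  by move=> xS; rewrite Hf mcoeffD (mcoeff_outdom xS) addr0.
have hS x : x \in S -> h@_x = 0.
  move=> xS; apply/mcoeff_outdom/negP => /(rcS _ (fdeg x)).
  by rewrite rc_fdeg xS.
have Sf x : x \in S -> x \in msupp f.
  by move=> xS; rewrite -mcoeff_neq0 Hf mcoeffD hS // add0r mcoeff_neq0.
have S1 : mone \notin S by apply/negP => /Sf; rewrite -mcoeff_neq0 Hconst eqxx.
have fstarS v : v \in S -> wstar v \in S -> f@_(wstar v) = f@_v.
  by move=> /Sf vf /Sf wf; apply: Hadj.
have h1 : h@_mone = 0 by rewrite -fhS.
have [h0|hn0] := eqVneq h 0; last first.
  (* Here U is disjoint from T since it consists of right chips of h. *)
  rewrite Eh in h1 rcS fhS hn0 *.
  apply: (infinitely_many_extensions (T := S) (U := sohs_supp gs)) => //.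
  - exact: uniq_sohs_supp.
  - rewrite lt0n size_eq0; apply: contra_neq hn0 => E0.
    by rewrite -/(sohs gs) (@sohs_expand _ _ [::]) ?big_nil // E0.
  - exact: one_notin_sohs_supp.
  - by move=> u /sohs_supp_rc[eta eh [i <-]]; apply: rcS.
  - by move=> _ u.
  - by move=> u us; exists u; rewrite // mem_cat us.
  - rewrite size_new_words ltnS -addnn (leq_trans _ (leq_add sizeS sizeS)) //.
    by rewrite leq_add2r count_size.
have Eh0 : h = sohs [::] by rewrite h0 /sohs big_nil.
have supp0 x : x \in msupp (sohs [::] : ncpoly R n) = false.
  by rewrite -Eh0 h0 msupp0 in_fset0.
rewrite Eh0 in fhS *.
have [v0 v0S] : exists v, v \in S.
  have [w wf _] := Hess (Ordinal Hn); exists w; apply: contraLR wf => /fhS.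
  by rewrite -Eh0 h0 mcoeff0 -mcoeff_eq0 => ->.
pose power k : word n := FMonom (nseq k (Ordinal Hn)).
have fdeg_power k : fdeg (power k) = k by rewrite fdegE /= size_nseq.
have power_neq1 k : power k.+1 != mone by rewrite -fdeg_eq0 fdeg_power.
have power_star k : wstar (power k) = power k.
  by apply: word_inj; rewrite /= rev_nseq.
have [/hasP[v vS /eqP Ev]|noself] := boolP (has (fun v => wstar v == v) S).
  (* The self-adjoint v needs no new adjoint; the term thus saved is the square
     of the power of degree m.+2 added to T. *)
  pose m := \max_(u <- S) fdeg u.
  have ltm k : (m < k)%N -> power k \notin S.
    move=> ltmk; apply: contraL ltmk => kS; rewrite -leqNgt.
    by rewrite -[k]fdeg_power; apply: leq_bigmax_seq.
  apply: (infinitely_many_extensions (T := power m.+2 :: S)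
    (U := [:: power m.+1])) => //.
  - by rewrite /= uS ltm.
  - by rewrite inE negb_or eq_sym power_neq1.
  - by move=> x; rewrite inE negb_or => /andP[_ /fhS].
  - move=> u; rewrite !inE => /predU1P[-> _|uS'].
      by rewrite power_star.
    case/predU1P => [E|]; last exact: fstarS.
    by rewrite E -[u]wstarK E power_star.
  - by move=> eta i; rewrite supp0.
  - by rewrite inE eq_sym power_neq1.
  - move=> u; rewrite !inE => /eqP ->; rewrite negb_or ltm // andbT.
    by apply/negP => /eqP/(congr1 (@fdeg _)); rewrite !fdeg_power => /eqP;
       rewrite ltn_eqF.
  - by rewrite -Eh0 h0 => /eqP.
  - move=> u; rewrite inE => /eqP ->; exists (power m.+2);
      last by rewrite !fdeg_power.
    by rewrite mem_cat mem_head orbT.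
  - rewrite size_new_words ltnS /= power_star eqxx add0n addnS -addSn -addnn.
    apply: leq_trans (leq_add sizeS sizeS); rewrite leq_add2r.
    rewrite -(count_predC (fun v => wstar v == v) S) -add1n leq_add2r -has_count.
    by apply/hasP; exists v; rewrite ?Ev.
(* A letter is self-adjoint, hence outside S, and no longer than v0. *)
apply: (infinitely_many_extensions (T := S) (U := [:: power 1])) => //.
- by move=> eta i; rewrite supp0.
- by rewrite inE eq_sym power_neq1.
- move=> u; rewrite inE => /eqP ->; apply: contra noself => pS; apply/hasP.
  by exists (power 1); rewrite ?power_star.
- by rewrite -Eh0 h0 => /eqP.
- move=> u; rewrite inE => /eqP ->; exists v0; rewrite ?mem_cat ?v0S ?orbT //.
  by rewrite fdeg_power lt0n fdeg_eq0; apply: contraNneq S1 => <-.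
- rewrite size_new_words ltnS -addnn (leq_trans _ (leq_add sizeS sizeS)) //.
  by rewrite leq_add2r count_size.
Qed.
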